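(* The Lorentzian geodesic flow is invariant under the extended Poincaré group: let $\psi(\mathbf x)=b\,A(\mathbf x)+\mathbf p$ be an element of the extended Poincaré group of $\mathbb R^n$ ($b\neq0$ a scalar, $A$ an orthogonal transformation, $\mathbf p\in\mathbb R^n$). Let $\Pi_0,\Pi_1$ be the hyperplanes in $\mathbb R^n$ defined by $\mathbf n_0\cdot\mathbf x=c_0$ and $\mathbf n_1\cdot\mathbf x=c_1$, with $\mathbf n_0,\mathbf n_1$ unit vectors and $\mathbf n_1\ne-\mathbf n_0$, and let $\gamma(t)=(\mathbf n_t,c_t\boldsymbol\epsilon)$, $0\le t\le 1$, be the Lorentzian geodesic flow from $\Pi_0$ to $\Pi_1$. Then $\tilde\psi(\gamma(t))$, $0\le t\le1$, is the Lorentzian geodesic flow from $\psi(\Pi_0)$ to $\psi(\Pi_1)$, these hyperplanes being represented by $\tilde\psi(\mathbf n_0,c_0\boldsymbol\epsilon)$ and $\tilde\psi(\mathbf n_1,c_1\boldsymbol\epsilon)$.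
   Context: The extended Poincaré group is the group generated by rigid transformations and (nonzero) scalar multiplications of $\mathbb R^n$. Write $\boldsymbol\epsilon=(1,1)$ and $\mathcal T^n=\{(\mathbf n,c\boldsymbol\epsilon)=(\mathbf n,c,c):\mathbf n\in S^{n-1},c\in\mathbb R\}$; the point $(\mathbf n,c\boldsymbol\epsilon)$ represents the (oriented) hyperplane $\mathbf n\cdot\mathbf x=c$. The Lorentzian geodesic flow from $z_0=(\mathbf n_0,c_0\boldsymbol\epsilon)$ to $z_1=(\mathbf n_1,c_1\boldsymbol\epsilon)$ with $\mathbf n_1\neq-\mathbf n_0$ is $\gamma(t)=\lambda(t,\theta)z_1+\lambda(1-t,\theta)z_0$, $0\le t\le1$, where $\theta\in[0,\pi)$, $\cos\theta=\mathbf n_0\cdot\mathbf n_1$, $\lambda(x,\theta)=\sin(x\theta)/\sin\theta$ for $\theta\ne0$ and $\lambda(x,0)=x$ (a geodesic of de Sitter space $\Lambda^{n+1}$ lying in $\mathcal T^n$). For $\psi(\mathbf x)=bA(\mathbf x)+\mathbf p$, the induced map $\tilde\psi:\mathcal T^n\to\mathcal T^n$ is $\tilde\psi(\mathbf n,c\boldsymbol\epsilon)=(A(\mathbf n),(bc+A(\mathbf n)\cdot\mathbf p)\boldsymbol\epsilon)$; it represents the image hyperplane under $\psi$ of the hyperplane represented by $(\mathbf n,c\boldsymbol\epsilon)$. *)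

(* Defs.v *)
From mathcomp Require Import all_boot all_order all_algebra.
From mathcomp Require Import ring lra.
From mathcomp Require Import all_classical all_reals all_analysis.

Set Implicit Arguments.
Unset Strict Implicit.
Unset Printing Implicit Defensive.
Import Order.TTheory GRing.Theory Num.Theory.
Local Open Scope classical_set_scope.
Local Open Scope ring_scope.

Section EuclideanSpace.
Context {R : realType} {n : nat}.

Definition dotv (u v : 'cV[R]_n) : R := \sum_(i < n) u i ord0 * v i ord0.

(* The matrix norm of MathComp-Analysis is the sup norm, hence [dotv]. *)
Definition unit_sphere : set 'cV[R]_n := [set v | dotv v v = 1].

Definition hyperplane (m : 'cV[R]_n) (c : R) : set 'cV[R]_n :=
  [set x | dotv m x = c].

Definition orthogonal_mx (A : 'M[R]_n) : Prop := A^T *m A = 1%:M.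

Inductive extended_poincare : ('cV[R]_n -> 'cV[R]_n) -> Prop :=
| EPRigid (A : 'M[R]_n) (p : 'cV[R]_n) :
    orthogonal_mx A -> extended_poincare (fun x => A *m x + p)
| EPScale (b : R) : b != 0 -> extended_poincare (fun x => b *: x)
| EPComp f g :
    extended_poincare f -> extended_poincare g -> extended_poincare (f \o g)
| EPInv f g :
    extended_poincare f -> cancel f g -> cancel g f -> extended_poincare g.

End EuclideanSpace.

Notation ambient R n := ('cV[R]_n * 'cV[R]_2)%type (only parsing).

Section LorentzianFlow.
Context {R : realType} {n : nat}.

Definition eps : 'cV[R]_2 := const_mx 1.

Definition tpoint (m : 'cV[R]_n) (c : R) : ambient R n := (m, c *: eps).

Definition Tn : set (ambient R n) :=
  [set z | exists m c, unit_sphere m /\ z = tpoint m c].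

Definition represents (z : ambient R n) (P : set 'cV[R]_n) : Prop :=
  exists m c, [/\ unit_sphere m, z = tpoint m c & P = hyperplane m c].

Definition lambda (x theta : R) : R :=
  if theta == 0 then x else sin (x * theta) / sin theta.

(* For unit vectors with v != - u this is the unique theta in [0, pi[ with
   cos theta = dotv u v; see [angleP]. *)
Definition angle (u v : 'cV[R]_n) : R := acos (dotv u v).

(* Only the values of [g] on [0, 1] are constrained. *)
Definition lorentzian_geodesic_flow (z0 z1 : ambient R n)
    (g : R -> ambient R n) : Prop :=
  [/\ Tn z0, Tn z1, z1.1 != - z0.1 &
      forall t : R, 0 <= t <= 1 ->
        g t = lambda t (angle z0.1 z1.1) *: z1
              + lambda (1 - t) (angle z0.1 z1.1) *: z0].

(* The map induced on Tn by x |-> b A x + p; [z.2 ord0 ord0] is the c of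
   z = tpoint m c, and the values outside Tn are irrelevant.  The map depends
   on the pair (b, A): (- b, - A) gives the same transformation of R^n but
   reverses the orientation of the image hyperplanes. *)
Definition induced_map (b : R) (A : 'M[R]_n) (p : 'cV[R]_n) (z : ambient R n) :
    ambient R n :=
  tpoint (A *m z.1) (b * z.2 ord0 ord0 + dotv (A *m z.1) p).

End LorentzianFlow.

Section Facts.
Context {R : realType} {n : nat}.
Implicit Types (u v w : 'cV[R]_n) (A : 'M[R]_n).

Lemma dotvC u v : dotv u v = dotv v u.
Proof. by apply: eq_bigr => i _; rewrite mulrC. Qed.

Lemma dotvDl u v w : dotv (u + v) w = dotv u w + dotv v w.
Proof.
by rewrite /dotv -big_split; apply: eq_bigr => i _; rewrite mxE mulrDl.
Qed.

Lemma dotvZl a u w : dotv (a *: u) w = a * dotv u w.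
Proof.
by rewrite /dotv mulr_sumr; apply: eq_bigr => i _; rewrite mxE mulrA.
Qed.

Lemma dotvDr u v w : dotv w (u + v) = dotv w u + dotv w v.
Proof. by rewrite dotvC dotvDl !(dotvC w). Qed.

Lemma dotvZr a u w : dotv w (a *: u) = a * dotv w u.
Proof. by rewrite dotvC dotvZl dotvC. Qed.

Lemma dotv_ge0 u : 0 <= dotv u u.
Proof. by apply: sumr_ge0 => i _; rewrite -expr2 sqr_ge0. Qed.

Lemma dotv_eq0 u : dotv u u = 0 -> u = 0.
Proof.
move=> /eqP; rewrite psumr_eq0; last by move=> i _; rewrite -expr2 sqr_ge0.
move=> /allP u0; apply/matrixP => i j; rewrite ord1 mxE.
by have := u0 i (mem_index_enum i); rewrite /= mulf_eq0 orbb => /eqP.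
Qed.

Lemma angleP u v : unit_sphere u -> unit_sphere v -> v != - u ->
  0 <= angle u v < pi /\ cos (angle u v) = dotv u v.
Proof.
rewrite /unit_sphere /= => u1 v1 vNu.
have duv (s : R) :
    dotv (v + s *: u) (v + s *: u) = 1 + 2 * s * dotv u v + s ^+ 2.
  by rewrite !(dotvDl, dotvDr, dotvZl, dotvZr) u1 v1 (dotvC v u); ring.
have lt : -1 < dotv u v.
  have := duv 1; rewrite scale1r => d1.
  rewrite ltNge; apply/negP => le.
  have : dotv (v + u) (v + u) = 0.
    by apply/eqP; rewrite eq_le dotv_ge0 andbT d1; lra.
  by move/dotv_eq0/eqP; rewrite addr_eq0 => /eqP vE; rewrite vE eqxx in vNu.
have le : dotv u v <= 1.
  have := dotv_ge0 (v + (-1) *: u); rewrite duv; lra.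
split; last by rewrite /angle acosK// in_itv/= (ltW lt) le.
by rewrite /angle acos_ge0 ?acos_ltpi ?lt ?le// (ltW lt).
Qed.

Lemma geodesic_flow_in_Tn (z0 z1 : ambient R n) g (t : R) :
  lorentzian_geodesic_flow z0 z1 g -> 0 <= t <= 1 -> Tn (g t).
Proof.
case=> -[m0 [c0 [u0 ->]]] [m1 [c1 [u1 ->]]] /= mN gE t01.
rewrite gE// /= /lambda.
have [] := angleP u0 u1 mN; set th := angle _ _ => /andP[th0 thpi] cth.
set l1 := if _ then t else _; set l0 := if _ then 1 - t else _.
exists (l1 *: m1 + l0 *: m0), (l1 * c1 + l0 * c0); split; last first.
  by congr (_, _); rewrite /= !scalerA -scalerDl.
rewrite /unit_sphere /= !(dotvDl, dotvDr, dotvZl, dotvZr) in u0 u1 *.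
rewrite u0 u1 (dotvC m1 m0) -cth {}/l1 {}/l0.
have [->|thN0] := eqVneq th 0; first by rewrite cos0; ring.
have s0 : sin th != 0.
  by rewrite gt_eqF// sin_gt0_pi// thpi lt_neqAle eq_sym thN0 th0.
have -> : (1 - t) * th = th - t * th by ring.
rewrite sinB.
have h1 := cos2Dsin2 th; have h2 := cos2Dsin2 (t * th).
have c2 : cos (t * th) ^+ 2 = 1 - sin (t * th) ^+ 2 by rewrite -h2; ring.
have c1' : cos th ^+ 2 = 1 - sin th ^+ 2 by rewrite -h1; ring.
apply: (mulIf (expf_neq0 2 s0)); rewrite mul1r.
transitivity (sin (t * th) ^+ 2 * (1 - cos th ^+ 2)
  + sin th ^+ 2 * cos (t * th) ^+ 2); first by field.
by rewrite c2 c1'; ring.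
Qed.

Lemma extended_poincareP (f : 'cV[R]_n -> 'cV[R]_n) :
  extended_poincare f <->
  exists b A p, [/\ b != 0, orthogonal_mx A &
                    forall x, f x = b *: (A *m x) + p].
Proof.
split=> [|[b [A [p [b0 oA fE]]]]]; last first.
  have -> : f = (fun x => 1%:M *m x + p) \o ((fun x => b *: x) \o
                 (fun x => A *m x + 0)).
    by apply/funext => x /=; rewrite fE addr0 mul1mx.
  apply: EPComp; first by apply: EPRigid; rewrite /orthogonal_mx trmx1 mul1mx.
  by apply: EPComp; [exact: EPScale|exact: EPRigid].
elim=> [A p oA|b b0|{}f g _ [b [A [p [b0 oA fE]]]] _ [b' [A' [p' [b'0 oA' gE]]]]
       |{}f g _ [b [A [p [b0 oA fE]]]] fK gK].
- by exists 1, A, p; split=> [||x]; rewrite ?oner_neq0 ?scale1r.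
- exists b, 1%:M, 0; split=> [//||x].
    by rewrite /orthogonal_mx trmx1 mul1mx.
  by rewrite mul1mx addr0.
- exists (b * b'), (A *m A'), (b *: (A *m p') + p); split=> [||x] /=.
  + by rewrite mulf_neq0.
  + by rewrite /orthogonal_mx trmx_mul mulmxA -(mulmxA _ _ A) oA mulmx1 oA'.
  + by rewrite gE fE mulmxDr -scalemxAr scalerDr scalerA mulmxA addrA.
- exists b^-1, A^T, (- (b^-1 *: (A^T *m p))); split=> [||x].
  + by rewrite invr_eq0.
  + by rewrite /orthogonal_mx trmxK; apply: mulmx1C.
  + rewrite -{2}(gK x) fE mulmxDr -scalemxAr mulmxA oA mul1mx scalerDr.
    by rewrite scalerA mulVf// scale1r addrK.
Qed.

End Facts.

(* Main.v *)
Require Import Defs.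
From mathcomp Require Import all_boot all_order all_algebra.
From mathcomp Require Import ring.
From mathcomp Require Import all_classical all_reals all_analysis.
Import Order.TTheory GRing.Theory Num.Theory.
Local Open Scope classical_set_scope.
Local Open Scope ring_scope.

(** The induced map acts on pairs [(m, c eps)] as the restriction of a linear
    map, so it commutes with the linear combination defining the flow; its
    coefficients depend only on the angle between the normals, which the
    orthogonal part [A] preserves. *)

Lemma dotv_orthogonal {R : realType} {n : nat} (A : 'M[R]_n) (u v : 'cV[R]_n) :
  orthogonal_mx A -> dotv (A *m u) (A *m v) = dotv u v.
Proof.
(* As a matrix product [x^T *m y], the form exposes the factor [A^T *m A], which cancels. *)
have dotvE (x y : 'cV[R]_n) : dotv x y = (x^T *m y) ord0 ord0.
  by rewrite !mxE; apply: eq_bigr => i _; rewrite mxE.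
by move=> oA; rewrite !dotvE trmx_mul mulmxA -(mulmxA u^T) oA mulmx1.
Qed.

Lemma tpoint_snd {R : realType} {n : nat} (m : 'cV[R]_n) (c : R) :
  (tpoint m c).2 ord0 ord0 = c.
Proof. by rewrite !mxE mulr1. Qed.

Lemma induced_map_tpoint {R : realType} {n : nat} (b : R) (A : 'M[R]_n)
    (p m : 'cV[R]_n) (c : R) :
  induced_map b A p (tpoint m c) = tpoint (A *m m) (b * c + dotv (A *m m) p).
Proof. by rewrite /induced_map tpoint_snd. Qed.

Lemma tpoint_lin {R : realType} {n : nat} (s t c d : R) (m k : 'cV[R]_n) :
  s *: tpoint m c + t *: tpoint k d = tpoint (s *: m + t *: k) (s * c + t * d).
Proof. by congr (_, _); rewrite /= scalerDl !scalerA. Qed.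

(** The translation [p] enters only through [dotv (A *m m) p], which is linear in the normal, so the
    new offset has no constant term. *)
Lemma induced_map_lin {R : realType} {n : nat} (b s t c d : R) (A : 'M[R]_n)
    (p m k : 'cV[R]_n) :
  induced_map b A p (s *: tpoint m c + t *: tpoint k d) =
  s *: induced_map b A p (tpoint m c) + t *: induced_map b A p (tpoint k d).
Proof.
rewrite tpoint_lin !induced_map_tpoint tpoint_lin mulmxDr -!scalemxAr.
by congr tpoint; rewrite dotvDl !dotvZl; ring.
Qed.

Lemma image_hyperplane {R : realType} {n : nat} (b : R) (A : 'M[R]_n)
    (p m : 'cV[R]_n) (c : R) :
  b != 0 -> orthogonal_mx A ->
  (fun x => b *: (A *m x) + p) @` hyperplane m c =
  hyperplane (A *m m) (b * c + dotv (A *m m) p).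
Proof.
move=> b0 oA; have oA' : A *m A^T = 1%:M by exact: mulmx1C.
apply/seteqP; split=> [_ [x /= mx <-]|y /= my].
  by rewrite /hyperplane /= dotvDr dotvZr dotv_orthogonal // mx.
(* The witness is the preimage of [y] under [x |-> b A x + p]. *)
exists (b^-1 *: (A^T *m (y - p))); last first.
  by rewrite -scalemxAr scalerA divff // scale1r mulmxA oA' mul1mx subrK.
(* Scaling by [b] and shifting turns the right side into that of [my]; applying [A] to both
   arguments of the product then cancels [A^T]. *)
apply: (mulfI b0); apply: (addIr (dotv (A *m m) p)); rewrite -my.
rewrite dotvZr mulrA divff // mul1r -(dotv_orthogonal A m _ oA).
by rewrite mulmxA oA' mul1mx -dotvDr subrK.
Qed.

(** The factor [b] is absorbed by the offset alone, so the normal [A *m m] stays a unit vector for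
    either sign of [b]. *)
Lemma represents_induced_map {R : realType} {n : nat} (b : R) (A : 'M[R]_n)
    (p m : 'cV[R]_n) (c : R) :
  b != 0 -> orthogonal_mx A -> unit_sphere m ->
  represents (induced_map b A p (tpoint m c))
    ((fun x => b *: (A *m x) + p) @` hyperplane m c).
Proof.
move=> b0 oA m1; rewrite image_hyperplane // induced_map_tpoint.
exists (A *m m), (b * c + dotv (A *m m) p); split=> //.
by rewrite /unit_sphere /= dotv_orthogonal.
Qed.

Theorem proposition5p1 (R : realType) (n : nat)
    (psi : 'cV[R]_n -> 'cV[R]_n) (b : R) (A : 'M[R]_n) (p : 'cV[R]_n)
    (n0 n1 : 'cV[R]_n) (c0 c1 : R) (gamma : R -> ambient R n)
    (psi_ep : extended_poincare psi)
    (b_neq0 : b != 0) (A_orth : orthogonal_mx A)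
    (psiE : forall x : 'cV[R]_n, psi x = b *: (A *m x) + p)
    (n0_unit : unit_sphere n0) (n1_unit : unit_sphere n1)
    (n1_neq : n1 != - n0)
    (gamma_flow :
       lorentzian_geodesic_flow (tpoint n0 c0) (tpoint n1 c1) gamma) :
  [/\ represents (induced_map b A p (tpoint n0 c0)) (psi @` hyperplane n0 c0),
      represents (induced_map b A p (tpoint n1 c1)) (psi @` hyperplane n1 c1) &
      lorentzian_geodesic_flow (induced_map b A p (tpoint n0 c0))
                               (induced_map b A p (tpoint n1 c1))
                               (fun t : R => induced_map b A p (gamma t))].
Proof.
have -> : psi = (fun x => b *: (A *m x) + p) by exact/funext.
have rep0 := represents_induced_map b A p n0 c0 b_neq0 A_orth n0_unit.
have rep1 := represents_induced_map b A p n1 c1 b_neq0 A_orth n1_unit.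
have [_ _ _ gammaE] := gamma_flow.
split=> //; split.
- by have [m [c [? ? _]]] := rep0; exists m, c.
- by have [m [c [? ? _]]] := rep1; exists m, c.
(* Antipodal image normals would pull back under [A^T] to antipodal normals. *)
- rewrite /= -mulmxN; apply: contra n1_neq => /eqP /(congr1 (mulmx A^T)).
  by rewrite !mulmxA A_orth !mul1mx => /eqP.
(* By linearity only the angles inside [lambda] remain to be compared, and these are [acos] of equal
   products. *)
- move=> t t01; rewrite (gammaE t t01) induced_map_lin /angle /=.
  by rewrite dotv_orthogonal.
Qed.
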